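(* Let $\alpha$ be a regular cardinal. The functor $\mathbf{U}_\alpha \colon \mathbf{sSets}^{\mathrm{op}} \to \mathbf{Sets}$, sending $X$ to the set of isomorphism classes of $\alpha$-small well-ordered fibrations over $X$, is representable, represented by the simplicial set $\mathrm{U}_\alpha$. The map $\pi \colon \widetilde{\mathrm{U}}_\alpha \to \mathrm{U}_\alpha$ is universal for $\alpha$-small well-ordered fibrations (every $\alpha$-small well-ordered fibration over $X$ is isomorphic, as a well-ordered morphism, to $h^*\pi$ for a unique map $h \colon X \to \mathrm{U}_\alpha$), and weakly universal for $\alpha$-small fibrations (every $\alpha$-small fibration is isomorphic to a pullback of $\pi$ along some, not necessarily unique, map from its base to $\mathrm{U}_\alpha$).
   Context: $\mathbf{sSets}$ is the category of simplicial sets; ''fibration'' means Kan fibration. A well-ordered morphism $f \colon Y \to X$ of simplicial sets is a map $f$ together with a choice, for every $n$ and every $x \in X_n$, of a well-ordering on the fiber $Y_x := f^{-1}(x) \subseteq Y_n$ (no compatibility between different fibers is required). An isomorphism of well-ordered morphisms $Y \to X$ and $Y' \to X$ is an isomorphism $Y \cong Y'$ over $X$ preserving the well-orderings of all fibers; there is at most one such isomorphism. The pullback $g^*f$ of a well-ordered morphism along $g \colon X' \to X$ is well-ordered via $(g^*Y)_{x'} \cong Y_{g(x')}$. Fix a regular cardinal $\alpha$ (infinite, as usual). A map $f$ is $\alpha$-small if every fiber $Y_x$ ($x\in X_n$, $n\ge 0$) has cardinality $<\alpha$. $\mathbf{W}_\alpha \colon \mathbf{sSets}^{\mathrm{op}}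 \to \mathbf{Sets}$ sends $X$ to the set of isomorphism classes of $\alpha$-small well-ordered morphisms into $X$, acting on maps by pullback; $\mathbf{U}_\alpha \subseteq \mathbf{W}_\alpha$ is the subfunctor of those whose underlying map is a fibration. $\mathrm{W}_\alpha$ is the simplicial set with $(\mathrm{W}_\alpha)_n = \mathbf{W}_\alpha(\Delta[n])$, and $\mathrm{U}_\alpha \subseteq \mathrm{W}_\alpha$ the simplicial subset with $(\mathrm{U}_\alpha)_n = \mathbf{U}_\alpha(\Delta[n])$. $\widetilde{\mathrm{W}}_\alpha \to \mathrm{W}_\alpha$ is the $\alpha$-small well-ordered morphism defined as follows: choosing a representative $f \colon Y \to \Delta[n]$ of each simplex of $\mathrm{W}_\alpha$, the $n$-simplices of $\widetilde{\mathrm{W}}_\alpha$ are pairs $([f \colon Y \to \Delta[n]], s)$ with $s \in f^{-1}(1_{[n]})$, and for $\theta \colon [m] \to [n]$ the action sends $([f],s)$ to $([\theta^*f], s')$, where $s'$ corresponds to $Y(\theta)(s) \in Y_\theta \cong (\theta^*Y)_{1_{[m]}}$ under the unique isomorphism with the chosen representative of $[\theta^*f]$; the fiber over $[f]$ has the well-ordering of $f^{-1}(1_{[n]})$. The well-ordered morphism $\pi \colon \widetilde{\mathrm{U}}_\alpha \to \mathrm{U}_\alpha$ is the pullback of $\widetilde{\mathrm{W}}_\alpha \to \mathrm{W}_\alpha$ along the inclusion $\mathrm{U}_\alpha \hookrightarrow \mathrm{W}_\alpha$. *)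

(* Defs.v *)
From mathcomp Require Import all_boot boolp classical_sets functions cardinality.
From mathcomp Require Import wochoice.

Set Implicit Arguments.
Unset Strict Implicit.
Unset Printing Implicit Defensive.

Local Open Scope classical_set_scope.
Local Open Scope card_scope.

(* A cardinal is given by a type of that cardinality. *)
Definition card_lt (T A : Type) : Prop :=
  ([set: T] #<= [set: A]) && ~~ ([set: A] #<= [set: T]).

Definition regular (A : Type) : Prop :=
  infinite_set [set: A] /\
  forall (I : Type) (F : I -> Type),
    card_lt I A -> (forall i, card_lt (F i) A) -> card_lt {i : I & F i} A.

Definition simp_mono m n (t : {ffun 'I_m.+1 -> 'I_n.+1}) : bool :=
  [forall i : 'I_m.+1, forall j : 'I_m.+1, (i <= j)%N ==> (t i <= t j)%N].

(* The morphisms [m] -> [n] of the simplex category: [n] = {0 < ... < n} is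
   ['I_n.+1]. *)
Definition simp_hom (m n : nat) : Type :=
  {t : {ffun 'I_m.+1 -> 'I_n.+1} | simp_mono t}.

Lemma simp_monoP m n (t : {ffun 'I_m.+1 -> 'I_n.+1}) :
  reflect (forall i j : 'I_m.+1, (i <= j)%N -> (t i <= t j)%N) (simp_mono t).
Proof.
apply: (iffP forallP) => [H i j | H i]; last by apply/forallP => j; apply/implyP/H.
by move: (H i) => /forallP/(_ j)/implyP.
Qed.

Lemma simp_id_mono n : simp_mono [ffun i : 'I_n.+1 => i].
Proof. by apply/simp_monoP => i j; rewrite !ffunE. Qed.

Definition simp_id n : simp_hom n n := exist (@simp_mono n n) _ (simp_id_mono n).

Lemma simp_comp_mono l m n (t : simp_hom m n) (s : simp_hom l m) :
  simp_mono [ffun i => val t (val s i)].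
Proof.
apply/simp_monoP => i j ij; rewrite !ffunE.
by apply/(simp_monoP _ (valP t))/(simp_monoP _ (valP s)).
Qed.

Definition simp_comp l m n (t : simp_hom m n) (s : simp_hom l m) : simp_hom l n :=
  exist (@simp_mono l n) _ (simp_comp_mono t s).

Lemma simp_hom_ext m n (t s : simp_hom m n) : val t =1 val s -> t = s.
Proof. by move=> ts; apply/val_inj/ffunP. Qed.

Lemma simp_compid m n (t : simp_hom m n) : simp_comp t (simp_id m) = t.
Proof. by apply: simp_hom_ext => i; rewrite !ffunE. Qed.

Lemma simp_idcomp m n (t : simp_hom m n) : simp_comp (simp_id n) t = t.
Proof. by apply: simp_hom_ext => i; rewrite !ffunE. Qed.

Lemma simp_compA k l m n (t : simp_hom m n) (s : simp_hom l m) (r : simp_hom k l) :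
  simp_comp t (simp_comp s r) = simp_comp (simp_comp t s) r.
Proof. by apply: simp_hom_ext => i; rewrite !ffunE. Qed.

Record sset_str (T : nat -> Type) := SsetStr {
  sact : forall m n, simp_hom m n -> T n -> T m;
  sact_id : forall n (x : T n), sact (simp_id n) x = x;
  sact_comp : forall l m n (t : simp_hom m n) (s : simp_hom l m) (x : T n),
    sact (simp_comp t s) x = sact s (sact t x)
}.

Record sSet := SSet {
  simplices :> nat -> Type;
  sset_strP : sset_str simplices
}.

Definition act (X : sSet) m n (t : simp_hom m n) (x : X n) : X m :=
  sact (sset_strP X) t x.

Lemma act_id (X : sSet) n (x : X n) : act (simp_id n) x = x.
Proof. exact: sact_id. Qed.

Lemma act_comp (X : sSet) l m n (t : simp_hom m n) (s : simp_hom l m) (x : X n) :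
  act (simp_comp t s) x = act s (act t x).
Proof. exact: sact_comp. Qed.

Record sset_hom (Y X : sSet) := SsetHom {
  hom_fun :> forall n, Y n -> X n;
  hom_act : forall m n (t : simp_hom m n) (y : Y n),
    hom_fun (act t y) = act t (hom_fun y)
}.
Arguments hom_fun {Y X} s n _.

Lemma sset_hom_ext (Y X : sSet) (f g : sset_hom Y X) :
  (forall n (y : Y n), f n y = g n y) -> f = g.
Proof.
case: f g => [f fP] [g gP] /= fg.
have {}fg : f = g by apply: functional_extensionality_dep => n; apply: funext => y.
by subst g; congr SsetHom; exact: Prop_irrelevance.
Qed.

Lemma sset_hom_eq (Y X : sSet) (f g : sset_hom Y X) :
  f = g -> forall n (y : Y n), f n y = g n y.
Proof. by move=> ->. Qed.

Definition hom_id (X : sSet) : sset_hom X X :=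
  @SsetHom X X (fun n x => x) (fun m n t x => erefl).

Lemma hom_comp_subproof (Z Y X : sSet) (f : sset_hom Y X) (g : sset_hom Z Y) m n
  (t : simp_hom m n) (z : Z n) : f m (g m (act t z)) = act t (f n (g n z)).
Proof. by rewrite !hom_act. Qed.

Definition hom_comp (Z Y X : sSet) (f : sset_hom Y X) (g : sset_hom Z Y) :
  sset_hom Z X := SsetHom (hom_comp_subproof f g).

Definition std_simplex (n : nat) : sSet :=
  @SSet (fun m => simp_hom m n)
    (@SsetStr (fun m => simp_hom m n) (fun _ _ t x => simp_comp x t)
       (fun _ => @simp_compid _ n) (fun _ _ _ t s x => simp_compA x t s)).

Definition std_map m n (t : simp_hom m n) :
    sset_hom (std_simplex m) (std_simplex n) :=
  @SsetHom (std_simplex m) (std_simplex n) (fun _ x => simp_comp t x)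
    (fun _ _ s x => simp_compA t x s).

Definition in_horn n (k : 'I_n.+1) m (x : simp_hom m n) : Prop :=
  exists i : 'I_n.+1, i <> k /\ forall j, val x j <> i.

Lemma in_horn_act n (k : 'I_n.+1) l m (t : simp_hom l m) (x : simp_hom m n) :
  in_horn k x -> in_horn k (simp_comp x t).
Proof. by case=> i [ik xi]; exists i; split=> // j; rewrite ffunE. Qed.

Definition horn_act n (k : 'I_n.+1) l m (t : simp_hom l m)
    (x : {x : simp_hom m n | in_horn k x}) : {x : simp_hom l n | in_horn k x} :=
  exist _ (simp_comp (proj1_sig x) t) (in_horn_act t (proj2_sig x)).

Lemma sig_ext T (P : T -> Prop) (x y : {x | P x}) :
  proj1_sig x = proj1_sig y -> x = y.
Proof. by case: x y => [x Px] [y Py] /= xy; apply: eq_exist. Qed.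

Lemma horn_str_subproof1 n (k : 'I_n.+1) m (x : {x : simp_hom m n | in_horn k x}) :
  horn_act (simp_id m) x = x.
Proof. by apply: sig_ext; rewrite /= simp_compid. Qed.

Lemma horn_str_subproof2 n (k : 'I_n.+1) l m p (t : simp_hom m p) (s : simp_hom l m)
    (x : {x : simp_hom p n | in_horn k x}) :
  horn_act (simp_comp t s) x = horn_act s (horn_act t x).
Proof. by apply: sig_ext; rewrite /= simp_compA. Qed.

(* The horn obtained from the standard simplex by removing the interior and
   the face opposite to the vertex k. *)
Definition horn n (k : 'I_n.+1) : sSet :=
  SSet (SsetStr (@horn_str_subproof1 n k) (@horn_str_subproof2 n k)).

Definition horn_incl n (k : 'I_n.+1) : sset_hom (horn k) (std_simplex n) :=
  @SsetHom (horn k) (std_simplex n) (fun _ x => proj1_sig x) (fun _ _ _ _ => erefl).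

(* The horns of dimension n.+1 are exactly those of dimension at least 1. *)
Definition kan_fibration (Y X : sSet) (f : sset_hom Y X) : Prop :=
  forall n (k : 'I_n.+2) (h : sset_hom (horn k) Y)
         (b : sset_hom (std_simplex n.+1) X),
    hom_comp f h = hom_comp b (horn_incl k) ->
    exists g : sset_hom (std_simplex n.+1) Y,
      hom_comp g (horn_incl k) = h /\ hom_comp f g = b.

Definition iso_over (X Y Y' : sSet) (f : sset_hom Y X) (f' : sset_hom Y' X) : Prop :=
  exists (u : sset_hom Y Y') (v : sset_hom Y' Y),
    [/\ hom_comp v u = hom_id Y, hom_comp u v = hom_id Y' & hom_comp f' u = f].

Definition fiber (T U : Type) (f : T -> U) (u : U) : Type := {t : T | f t = u}.

Definition small (A : Type) (Y X : sSet) (f : sset_hom Y X) : Prop :=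
  forall n (x : X n), card_lt (fiber (f n) x) A.

(* The structure, on Y, of domain of an A-small well-ordered morphism into X. *)
Record swo_str (A : Type) (X Y : sSet) := SwoStr {
  prj : sset_hom Y X;
  wo_rel : forall n (x : X n), rel (fiber (prj n) x);
  wo_relP : forall n (x : X n), well_order (wo_rel (x := x));
  prj_small : small A prj
}.

Record swo (A : Type) (X : sSet) := Swo {
  tot : sSet;
  swo_strP :> swo_str A X tot
}.

Record wo_iso (A : Type) (X : sSet) (f g : swo A X) := WoIso {
  iso_fun : sset_hom (tot f) (tot g);
  iso_inv : sset_hom (tot g) (tot f);
  iso_funK : hom_comp iso_inv iso_fun = hom_id (tot f);
  iso_invK : hom_comp iso_fun iso_inv = hom_id (tot g);
  iso_prj : hom_comp (prj g) iso_fun = prj f;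
  iso_rel : forall n (x : X n) (y1 y2 : fiber (prj f n) x) (z1 z2 : fiber (prj g n) x),
    proj1_sig z1 = iso_fun n (proj1_sig y1) ->
    proj1_sig z2 = iso_fun n (proj1_sig y2) ->
    wo_rel z1 z2 = wo_rel y1 y2
}.

Section WellOrder.
Variables (T : Type) (R : rel T).
Hypothesis Rwo : well_order R.

Lemma wo_min (P : T -> Prop) t : P t -> exists2 m, P m & forall x, P x -> R m x.
Proof.
move=> Pt; have [|m [[Pm lbm] _]] := Rwo (A := [pred x | `[< P x >]]).
  by exists t; apply/asboolP.
by exists m; [apply/asboolP | move=> x Px; apply/lbm/asboolP].
Qed.

Lemma wo_total x y : R x y \/ R y x.
Proof.
have [|m [->|->] lbm] := @wo_min (fun z => z = x \/ z = y) x; first by left.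
- by left; apply: lbm; right.
- by right; apply: lbm; left.
Qed.

Lemma wo_refl x : R x x.
Proof. by case: (wo_total x x). Qed.

Lemma wo_anti x y : R x y -> R y x -> x = y.
Proof.
move=> xy yx; have [|m [_ um]] := Rwo (A := [pred z | `[< z = x \/ z = y >]]).
  by exists x; apply/asboolP; left.
have /um <- : minimum_of R [pred z | `[< z = x \/ z = y >]] x.
  by split; [apply/asboolP; left | move=> z /asboolP[->|->] //; apply: wo_refl].
have /um -> // : minimum_of R [pred z | `[< z = x \/ z = y >]] y.
by split; [apply/asboolP; right | move=> z /asboolP[->|->] //; apply: wo_refl].
Qed.

Lemma wo_incr (f : T -> T) : injective f -> {homo f : x y / R x y} ->
  forall x, R x (f x).
Proof.
move=> finj fR x; apply: contrapT => xNfx.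
have [m mNfm mmin] := @wo_min (fun x => ~ R x (f x)) x xNfx.
have fmm : R (f m) m by case: (wo_total m (f m)).
apply/(mNfm)/mmin => fmffm; apply: mNfm.
by have /finj <- := wo_anti fmffm (fR _ _ fmm); apply: wo_refl.
Qed.

Lemma wo_transport S (e : S -> T) (e' : T -> S) :
  cancel e e' -> cancel e' e -> well_order (fun a b => R (e a) (e b)).
Proof.
move=> eK e'K A [a Aa].
have [|m Am mmin] := @wo_min (fun t => e' t \in A) (e a); first by rewrite eK.
exists (e' m); split=> [|b [Ab bmin]].
  by split=> // b Ab; rewrite e'K; apply: mmin; rewrite eK.
rewrite -(eK b); congr e'; apply: wo_anti; first by apply: mmin; rewrite eK.
by rewrite -(e'K m); apply: bmin.
Qed.
End WellOrder.

Lemma card_le_inj (T U : Type) (f : T -> U) : injective f -> [set: T] #<= [set: U].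
Proof.
move=> finj; apply/card_leP.
have [g _ ginj] : exists2 g : [set: T] -> [set: U], set_fun setT setT g & set_inj setT g.
  exists (fun t => SigSub (mem_set (I : [set: U] (f (val t))))) => // x y _ _ [] /finj.
  by move/val_inj.
by apply/injfunPex; exists g.
Qed.

Lemma card_lt_can (A T U : Type) (f : T -> U) (g : U -> T) :
  cancel f g -> cancel g f -> card_lt U A -> card_lt T A.
Proof.
move=> fK gK /andP[UA AU]; apply/andP; split.
  by apply: card_le_trans UA; apply: card_le_inj (can_inj fK).
by apply: contra AU => /card_le_trans; apply; apply: card_le_inj (can_inj fK).
Qed.

Section Isos.
Variables (A : Type) (X : sSet).
Implicit Types f g h : swo A X.

Lemma iso_funKE f g (u : wo_iso f g) n : cancel (iso_fun u n) (iso_inv u n).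
Proof. by move=> y; exact (sset_hom_eq (iso_funK u) y). Qed.

Lemma iso_invKE f g (u : wo_iso f g) n : cancel (iso_inv u n) (iso_fun u n).
Proof. by move=> y; exact (sset_hom_eq (iso_invK u) y). Qed.

Lemma iso_prjE f g (u : wo_iso f g) n y : prj g n (iso_fun u n y) = prj f n y.
Proof. exact (sset_hom_eq (iso_prj u) y). Qed.

Lemma iso_prjVE f g (u : wo_iso f g) n y : prj f n (iso_inv u n y) = prj g n y.
Proof. by rewrite -(iso_prjE u) iso_invKE. Qed.

Lemma wo_iso_refl f : wo_iso f f.
Proof.
exists (hom_id _) (hom_id _); do ?[exact: sset_hom_ext].
move=> n x [y1 y1x] [y2 y2x] [z1 z1x] [z2 z2x] /= e1 e2; subst z1 z2.
by congr wo_rel; apply: sig_ext.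
Defined.

Lemma wo_iso_sym f g : wo_iso f g -> wo_iso g f.
Proof.
move=> u; exists (iso_inv u) (iso_fun u).
- exact: iso_invK.
- exact: iso_funK.
- by apply: sset_hom_ext => n y /=; rewrite iso_prjVE.
- move=> n x y1 y2 z1 z2 e1 e2; apply/esym/(iso_rel (w := u)).
  + by rewrite e1 iso_invKE.
  + by rewrite e2 iso_invKE.
Defined.

Definition iso_fib f g (u : wo_iso f g) n (x : X n) (y : fiber (prj f n) x) :
    fiber (prj g n) x :=
  exist _ (iso_fun u n (proj1_sig y)) (etrans (iso_prjE u _) (proj2_sig y)).

Lemma wo_iso_trans f g h : wo_iso f g -> wo_iso g h -> wo_iso f h.
Proof.
move=> u v; exists (hom_comp (iso_fun v) (iso_fun u)) (hom_comp (iso_inv u) (iso_inv v)).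
- by apply: sset_hom_ext => n y /=; rewrite !iso_funKE.
- by apply: sset_hom_ext => n y /=; rewrite !iso_invKE.
- by apply: sset_hom_ext => n y /=; rewrite !iso_prjE.
- move=> n x y1 y2 z1 z2 e1 e2.
  rewrite (iso_rel (w := v) (y1 := iso_fib u y1) (y2 := iso_fib u y2)) //.
  exact: (iso_rel (w := u)).
Defined.

Lemma wo_aut_incr f (u : wo_iso f f) n (x : X n) (y : fiber (prj f n) x) :
  wo_rel y (iso_fib u y).
Proof.
apply: (wo_incr (@wo_relP _ _ _ f n x)) => [y1 y2 /(congr1 (@proj1_sig _ _)) /= | y1 y2].
  by move/(can_inj (iso_funKE u (n := n))) => e; apply: sig_ext.
by rewrite (iso_rel (w := u) (y1 := y1) (y2 := y2)).
Qed.

Lemma wo_aut_id f (u : wo_iso f f) n y : iso_fun u n y = y.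
Proof.
pose y' : fiber (prj f n) (prj f n y) := exist _ y erefl.
have /(congr1 (@proj1_sig _ _)) // : iso_fib u y' = y'.
apply: (wo_anti (@wo_relP _ _ _ f n _)); last exact: wo_aut_incr.
have := wo_aut_incr (wo_iso_sym u) (iso_fib u y').
congr wo_rel; apply: sig_ext => /=; exact: iso_funKE.
Qed.

Lemma wo_iso_unique f g (u v : wo_iso f g) n y : iso_fun u n y = iso_fun v n y.
Proof.
have /= := wo_aut_id (wo_iso_trans u (wo_iso_sym v)) y.
by move=> {2}<-; rewrite iso_invKE.
Qed.
End Isos.

Section PullbackSet.
Variables (X X' Y : sSet) (g : sset_hom X' X) (f : sset_hom Y X).

Definition pb_simp n : Type := {p : X' n * Y n | g n p.1 = f n p.2}.

Lemma pb_act_subproof m n (t : simp_hom m n) (p : pb_simp n) :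
  g m (act t (proj1_sig p).1) = f m (act t (proj1_sig p).2).
Proof. by rewrite !hom_act (proj2_sig p). Qed.

Definition pb_act m n (t : simp_hom m n) (p : pb_simp n) : pb_simp m :=
  exist _ (act t (proj1_sig p).1, act t (proj1_sig p).2) (pb_act_subproof t p).

Lemma pb_act_id n (p : pb_simp n) : pb_act (simp_id n) p = p.
Proof. by apply: sig_ext; rewrite /= !act_id -surjective_pairing. Qed.

Lemma pb_act_comp l m n (t : simp_hom m n) (s : simp_hom l m) (p : pb_simp n) :
  pb_act (simp_comp t s) p = pb_act s (pb_act t p).
Proof. by apply: sig_ext; rewrite /= !act_comp. Qed.

Definition pb : sSet := SSet (SsetStr pb_act_id pb_act_comp).

Definition pb_fst : sset_hom pb X' :=
  @SsetHom pb X' (fun _ p => (proj1_sig p).1) (fun _ _ _ _ => erefl).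

Definition pb_snd : sset_hom pb Y :=
  @SsetHom pb Y (fun _ p => (proj1_sig p).2) (fun _ _ _ _ => erefl).

Lemma pb_fib_subproof n (x : X' n) (p : fiber (pb_fst n) x) :
  f n (pb_snd n (proj1_sig p)) = g n x.
Proof. by case: p => [[[x' y] /= e] /= <-]. Qed.

Definition pb_fib n (x : X' n) (p : fiber (pb_fst n) x) : fiber (f n) (g n x) :=
  exist _ (pb_snd n (proj1_sig p)) (pb_fib_subproof p).

Definition pb_unfib n (x : X' n) (y : fiber (f n) (g n x)) : fiber (pb_fst n) x :=
  exist _ (exist _ (x, proj1_sig y) (esym (proj2_sig y))) erefl.

Lemma pb_fibK n (x : X' n) : cancel (@pb_fib n x) (@pb_unfib n x).
Proof. by case=> [[[x' y] /= e] /= xx']; subst x'; do 2!apply: sig_ext. Qed.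

Lemma pb_unfibK n (x : X' n) : cancel (@pb_unfib n x) (@pb_fib n x).
Proof. by move=> y; apply: sig_ext. Qed.

Lemma pb_small A : small A f -> small A pb_fst.
Proof.
by move=> fA n x; apply: card_lt_can (fA n (g n x)); [apply: pb_fibK|apply: pb_unfibK].
Qed.

Lemma pb_kan : kan_fibration f -> kan_fibration pb_fst.
Proof.
move=> fK n k h b hb.
have [|u [uh ub]] := fK n k (hom_comp pb_snd h) (hom_comp g b).
  apply: sset_hom_ext => m y /=.
  rewrite -[RHS]/(g m (hom_comp b (horn_incl k) m y)) -hb /=.
  exact/esym/(proj2_sig (h m y)).
have uE m y : g m (b m y) = f m (u m y).
  exact (sset_hom_eq (esym ub) y).
have vP m p (t : simp_hom m p) y :
    exist (fun q => g m q.1 = f m q.2) (b m (act t y), u m (act t y)) (uE m (act t y)) =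
    pb_act t (exist _ (b p y, u p y) (uE p y)).
  by apply: sig_ext; rewrite /= !hom_act.
exists (@SsetHom (std_simplex n.+1) pb
          (fun m y => exist (fun q => g m q.1 = f m q.2) (b m y, u m y) (uE m y)) vP).
split; apply: sset_hom_ext => m y //=; apply: sig_ext => /=.
rewrite [RHS]surjective_pairing; congr pair.
- exact (sset_hom_eq (esym hb) y).
- exact (sset_hom_eq uh y).
Qed.
End PullbackSet.

Section Pullback.
Variable A : Type.

Lemma pb_relP (X X' : sSet) (g : sset_hom X' X) (f : swo A X) n (x : X' n) :
  well_order (fun p q : fiber (pb_fst g (prj f) n) x => wo_rel (pb_fib p) (pb_fib q)).
Proof.
apply: wo_transport; [exact: wo_relP | exact: pb_fibK | exact: pb_unfibK].
Qed.

Definition pullback (X X' : sSet) (g : sset_hom X' X) (f : swo A X) : swo A X' :=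
  @Swo A X' (pb g (prj f))
    (SwoStr (@pb_relP X X' g f) (pb_small g (@prj_small _ _ _ f))).

Definition pb_iso_fun (X X' : sSet) (g : sset_hom X' X) (f f' : swo A X)
    (u : wo_iso f f') : sset_hom (tot (pullback g f)) (tot (pullback g f')).
Proof.
exists (fun n (p : pb_simp g (prj f) n) =>
   exist (fun q : X' n * tot f' n => g n q.1 = prj f' n q.2)
     ((proj1_sig p).1, iso_fun u n (proj1_sig p).2)
     (etrans (proj2_sig p) (esym (iso_prjE u _)))).
by move=> m n t p; apply: sig_ext; rewrite /= hom_act.
Defined.

Lemma pb_iso (X X' : sSet) (g : sset_hom X' X) (f f' : swo A X) :
  wo_iso f f' -> wo_iso (pullback g f) (pullback g f').
Proof.
move=> u; exists (pb_iso_fun g u) (pb_iso_fun g (wo_iso_sym u)).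
- by apply: sset_hom_ext => n [[x y] e]; apply: sig_ext; rewrite /= iso_funKE.
- by apply: sset_hom_ext => n [[x y] e]; apply: sig_ext; rewrite /= iso_invKE.
- exact: sset_hom_ext.
- move=> n x y1 y2 z1 z2 e1 e2 /=.
  by apply: (iso_rel (w := u)) => /=; rewrite ?e1 ?e2.
Defined.

Lemma pb_id (X : sSet) (f : swo A X) : wo_iso (pullback (hom_id X) f) f.
Proof.
unshelve eexists.
- exact: pb_snd.
- unshelve eexists.
  + by move=> n y; exists (prj f n y, y).
  + by move=> m n t y; apply: sig_ext; rewrite /= hom_act.
- by apply: sset_hom_ext => n [[x y] /= e]; apply: sig_ext; rewrite /= -e.
- exact: sset_hom_ext.
- by apply: sset_hom_ext => n [[x y] /= e].
- move=> n x y1 y2 z1 z2 e1 e2 /=.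
  by congr wo_rel; apply: sig_ext => /=; rewrite ?e1 ?e2.
Defined.

Lemma pb_comp (X X' X'' : sSet) (g : sset_hom X' X) (k : sset_hom X'' X') (f : swo A X) :
  wo_iso (pullback k (pullback g f)) (pullback (hom_comp g k) f).
Proof.
unshelve eexists.
- unshelve eexists.
  + move=> n [[x [[x' y] /= e]] /= e']; exists (x, y).
    by rewrite /= e' -e.
  + by move=> m n t [[x [[x' y] /= e]] /= e']; apply: sig_ext.
- unshelve eexists.
  + move=> n [[x y] /= e].
    by exists (x, exist (fun q : X' n * tot f n => g n q.1 = prj f n q.2) (k n x, y) e).
  + move=> m n t [[x y] /= e]; apply: sig_ext => /=; congr pair.
    by apply: sig_ext; rewrite /= hom_act.
- apply: sset_hom_ext => n [[x [[x' y] /= e]] /= e']; apply: sig_ext => /=; congr pair.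
  by apply: sig_ext; rewrite /= e'.
- by apply: sset_hom_ext => n [[x y] /= e]; apply: sig_ext.
- by apply: sset_hom_ext => n [[x [[x' y] /= e]] /= e'].
- move=> n x [[[x1 [[x1' y1] /= a1]] /= b1] /= c1] [[[x2 [[x2' y2] /= a2]] /= b2] /= c2].
  move=> z1 z2 /= e1 e2.
  by congr wo_rel; apply: sig_ext => /=; rewrite ?e1 ?e2.
Defined.

(* A well-ordered morphism into X whose domain has as n-simplices a subset of
   X_n * A. Unlike [swo A X], [rep A X] lies in the universe of the simplices,
   and every A-small well-ordered morphism is isomorphic to one of this form. *)
Record rep (X : sSet) := Rep {
  rep_car : forall n, X n * A -> Prop;
  rep_sset : sset_str (fun n => {p : X n * A | rep_car p});
  rep_str : swo_str A X (SSet rep_sset)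
}.

Definition swo_of_rep (X : sSet) (r : rep X) : swo A X := Swo (rep_str r).

(* The isomorphism class of f, cut down to the small set [rep X]. *)
Definition class_of (X : sSet) (f : swo A X) : rep X -> Prop :=
  fun r => $|wo_iso (swo_of_rep r) f|.

Definition iso_class (X : sSet) : Type :=
  {P : rep X -> Prop | exists f : swo A X, P = class_of f}.

Definition class (X : sSet) (f : swo A X) : iso_class X :=
  exist _ (class_of f) (ex_intro _ f erefl).

Lemma rep_exists (X : sSet) (f : swo A X) :
  exists r : rep X, $|wo_iso (swo_of_rep r) f|.
Proof.
have inj n (x : X n) : exists e : fiber (prj f n) x -> A, injective e.
  have /andP[/card_leP[e] _] := @prj_small _ _ _ f n x.
  exists (fun y => val (e (SigSub (mem_set (I : [set: fiber (prj f n) x] y))))).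
  move=> y y' /val_inj yy'.
  by have [] := @inj _ _ _ e _ _ (mem_set I) (mem_set I) yy'.
pose e n x := proj1_sig (cid (inj n x)).
have eI n x : injective (e n x) := proj2_sig (cid (inj n x)).
pose c n (y : tot f n) : X n * A := (prj f n y, e n _ (exist _ y erefl)).
have cI n : injective (c n).
  move=> y y' [xx'].
  have -> : e n (prj f n y) (exist _ y erefl) = e n (prj f n y') (exist _ y xx').
    by case: _ / xx'.
  by move/eI => -[].
pose P n (p : X n * A) := exists y, c n y = p.
pose T n := {p | P n p}.
pose a n (y : tot f n) : T n := exist _ (c n y) (ex_intro _ y erefl).
pose b n (p : T n) : tot f n := proj1_sig (cid (proj2_sig p)).
have bK n : cancel (b n) (a n).
  by move=> p; apply: sig_ext; rewrite /= /b; case: cid.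
have aK n : cancel (a n) (b n) by move=> y; apply: cI; rewrite /b; case: cid.
have aid n x : a n (act (simp_id n) (b n x)) = x by rewrite act_id bK.
have acomp l m n t s x :
    a l (act (@simp_comp l m n t s) (b n x)) = a l (act s (b m (a m (act t (b n x))))).
  by rewrite aK act_comp.
pose Z := SSet (@SsetStr T (fun m n t x => a m (act t (b n x))) aid acomp).
have bact m n t (x : Z n) : b m (act t x) = act t (b n x) by rewrite /= aK.
have aact m n t (y : tot f n) : a m (act t y) = act t (a n y : Z n).
  by rewrite /act /= aK.
pose bh : sset_hom Z (tot f) := SsetHom bact.
pose ah : sset_hom (tot f) Z := @SsetHom (tot f) Z a aact.
pose q := hom_comp (prj f) bh.
pose bf n (x : X n) (z : fiber (q n) x) : fiber (prj f n) x :=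
  exist _ (b n (proj1_sig z)) (proj2_sig z).
have af_subproof n (x : X n) (y : fiber (prj f n) x) : q n (a n (proj1_sig y)) = x.
  by rewrite /= aK (proj2_sig y).
pose af n (x : X n) (y : fiber (prj f n) x) : fiber (q n) x :=
  exist _ (a n (proj1_sig y)) (af_subproof n x y).
have bfK n x : cancel (bf n x) (af n x) by move=> z; apply: sig_ext; rewrite /= bK.
have afK n x : cancel (af n x) (bf n x) by move=> z; apply: sig_ext; rewrite /= aK.
have qwo n (x : X n) : well_order (fun z z' : fiber (q n) x => wo_rel (bf n x z) (bf n x z')).
  by apply: wo_transport (bfK n x) (afK n x); apply: wo_relP.
have qsmall : small A q.
  by move=> n x; apply: card_lt_can (bfK n x) (afK n x) _; apply: (@prj_small _ _ _ f).
exists (@Rep X P _ (@SwoStr A X Z q _ qwo qsmall)); apply: squash.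
exists bh ah.
- by apply: sset_hom_ext => n z /=; rewrite bK.
- by apply: sset_hom_ext => n z /=; rewrite aK.
- exact: sset_hom_ext.
- by move=> n x y1 y2 z1 z2 e1 e2; congr wo_rel; apply: sig_ext.
Qed.

Lemma class_eqP (X : sSet) (f g : swo A X) : class f = class g <-> $|wo_iso f g|.
Proof.
split=> [/(congr1 (@proj1_sig _ _)) /= fg | [u]].
  have [r rf] := rep_exists f.
  have [v] : class_of g r by rewrite -fg.
  by case: rf => u; apply: squash; apply: wo_iso_trans (wo_iso_sym u) v.
apply: sig_ext => /=; apply: funext => r; apply: propext; split=> -[v]; apply: squash.
- exact: wo_iso_trans v u.
- exact: wo_iso_trans v (wo_iso_sym u).
Qed.

Lemma classP (X : sSet) (c : iso_class X) : exists f : swo A X, class f = c.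
Proof. by case: c => P [f Pf]; exists f; apply: sig_ext. Qed.

Definition class_pullback (X X' : sSet) (g : sset_hom X' X) (c : iso_class X) :
    iso_class X' :=
  class (pullback g (proj1_sig (cid (classP c)))).

Lemma class_pullbackE (X X' : sSet) (g : sset_hom X' X) (f : swo A X) :
  class_pullback g (class f) = class (pullback g f).
Proof.
rewrite /class_pullback; case: cid => f' /= /class_eqP[u].
by apply/class_eqP/squash/pb_iso.
Qed.

Lemma class_pullback_id (X : sSet) (c : iso_class X) : class_pullback (hom_id X) c = c.
Proof.
by have [f <-] := classP c; rewrite class_pullbackE; apply/class_eqP/squash/pb_id.
Qed.

Lemma class_pullback_comp (X X' X'' : sSet) (g : sset_hom X' X) (k : sset_hom X'' X')
    (c : iso_class X) :
  class_pullback (hom_comp g k) c = class_pullback k (class_pullback g c).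
Proof.
have [f <-] := classP c; rewrite !class_pullbackE.
by apply/esym/class_eqP/squash/pb_comp.
Qed.
End Pullback.

Record presheaf := Presheaf {
  psh_obj :> sSet -> Type;
  psh_map : forall X X' : sSet, sset_hom X' X -> psh_obj X -> psh_obj X';
  psh_id : forall (X : sSet) (c : psh_obj X), psh_map (hom_id X) c = c;
  psh_comp : forall (X X' X'' : sSet) (g : sset_hom X' X) (k : sset_hom X'' X')
    (c : psh_obj X), psh_map (hom_comp g k) c = psh_map k (psh_map g c)
}.

Definition represented_by (F : presheaf) (R : sSet) : Prop :=
  exists eta : forall X : sSet, sset_hom X R -> F X,
    (forall (X X' : sSet) (g : sset_hom X' X) (h : sset_hom X R),
       eta X' (hom_comp h g) = psh_map g (eta X h)) /\
    (forall X : sSet, bijective (eta X)).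

Section SsetOfPresheaf.
Variable F : presheaf.

Definition psh_act m n (t : simp_hom m n) (c : F (std_simplex n)) :
    F (std_simplex m) := psh_map (std_map t) c.

Lemma psh_act_id n (c : F (std_simplex n)) : psh_act (simp_id n) c = c.
Proof.
rewrite /psh_act -[RHS]psh_id; congr psh_map.
by apply: sset_hom_ext => m x; apply: simp_idcomp.
Qed.

Lemma psh_act_comp l m n (t : simp_hom m n) (s : simp_hom l m) (c : F (std_simplex n)) :
  psh_act (simp_comp t s) c = psh_act s (psh_act t c).
Proof.
rewrite /psh_act -psh_comp; congr psh_map.
by apply: sset_hom_ext => k x; apply/esym/simp_compA.
Qed.

Definition sset_of_psh : sSet := SSet (SsetStr psh_act_id psh_act_comp).
End SsetOfPresheaf.

Section Universe.
Variable A : Type.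

Definition W_functor : presheaf := Presheaf (@class_pullback_id A) (@class_pullback_comp A).

Definition fibrant_class (X : sSet) (c : iso_class A X) : Prop :=
  exists f : swo A X, kan_fibration (prj f) /\ class f = c.

Lemma fibrant_class_pullback (X X' : sSet) (g : sset_hom X' X) (c : iso_class A X) :
  fibrant_class c -> fibrant_class (class_pullback g c).
Proof.
move=> [f [fK <-]]; exists (pullback g f); split; first exact: pb_kan.
by rewrite class_pullbackE.
Qed.

Definition fclass_pullback (X X' : sSet) (g : sset_hom X' X)
    (c : {c : iso_class A X | fibrant_class c}) :
    {c : iso_class A X' | fibrant_class c} :=
  exist _ (class_pullback g (proj1_sig c)) (fibrant_class_pullback g (proj2_sig c)).

Lemma fclass_pullback_id (X : sSet) (c : {c : iso_class A X | fibrant_class c}) :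
  fclass_pullback (hom_id X) c = c.
Proof. by apply: sig_ext; apply: class_pullback_id. Qed.

Lemma fclass_pullback_comp (X X' X'' : sSet) (g : sset_hom X' X) (k : sset_hom X'' X')
    (c : {c : iso_class A X | fibrant_class c}) :
  fclass_pullback (hom_comp g k) c = fclass_pullback k (fclass_pullback g c).
Proof. by apply: sig_ext; apply: class_pullback_comp. Qed.

Definition U_functor : presheaf := Presheaf fclass_pullback_id fclass_pullback_comp.

Definition W : sSet := sset_of_psh W_functor.
Definition U : sSet := sset_of_psh U_functor.

Definition U_incl : sset_hom U W :=
  @SsetHom U W (fun _ c => proj1_sig c) (fun _ _ _ _ => erefl).

Record representatives := Representatives {
  rep_of :> forall n, W n -> swo A (std_simplex n);
  rep_ofP : forall n (c : W n), class (rep_of c) = c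
}.

Lemma representatives_exist : $|representatives|.
Proof.
apply: squash; exists (fun n c => proj1_sig (cid (classP c))) => n c.
exact: proj2_sig (cid (classP c)).
Qed.

Variable rho : representatives.

Lemma Wt_iso_subproof m n (t : simp_hom m n) (c : W n) :
  $|wo_iso (pullback (std_map t) (rho n c)) (rho m (act t c))|.
Proof.
by apply/class_eqP; rewrite -class_pullbackE !rep_ofP.
Qed.

Definition Wt_iso m n (t : simp_hom m n) (c : W n) :
    wo_iso (pullback (std_map t) (rho n c)) (rho m (act t c)) :=
  unsquash (Wt_iso_subproof t c).

(* The pairs of a simplex c of W and an element, in the fiber over the identity
   of [n], of the domain of the representative of c. *)
Definition Wt_simp n : Type := {c : W n & fiber (prj (rho n c) n) (simp_id n)}.

Lemma Wt_pt_subproof m n (t : simp_hom m n) (p : Wt_simp n) :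
  std_map t m (simp_id m) = prj (rho n (projT1 p)) m (act t (proj1_sig (projT2 p))).
Proof.
by rewrite hom_act (proj2_sig (projT2 p)) /= simp_compid; apply/esym/simp_idcomp.
Qed.

Definition Wt_pt m n (t : simp_hom m n) (p : Wt_simp n) :
    fiber (prj (pullback (std_map t) (rho n (projT1 p))) m) (simp_id m) :=
  exist _ (exist _ (simp_id m, act t (proj1_sig (projT2 p))) (Wt_pt_subproof t p)) erefl.

Definition Wt_act m n (t : simp_hom m n) (p : Wt_simp n) : Wt_simp m :=
  existT _ (act t (projT1 p)) (iso_fib (Wt_iso t (projT1 p)) (Wt_pt t p)).

Lemma Wt_ext n (p q : Wt_simp n) (u : wo_iso (rho n (projT1 p)) (rho n (projT1 q))) :
  iso_fun u n (proj1_sig (projT2 p)) = proj1_sig (projT2 q) -> p = q.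
Proof.
case: p q u => [c s] [d r] /= u.
have cd : c = d by rewrite -(rep_ofP rho c) -(rep_ofP rho d); apply/class_eqP/squash.
by subst d; rewrite wo_aut_id => sr; congr existT; apply: sig_ext.
Qed.

Lemma pb_eq X X' (g g' : sset_hom X' X) (f : swo A X) : g = g' ->
  {u : wo_iso (pullback g f) (pullback g' f) |
     forall n p, (proj1_sig (iso_fun u n p)).2 = (proj1_sig p).2}.
Proof. by move=> <-; exists (wo_iso_refl _). Qed.

Lemma Wt_act_id n (p : Wt_simp n) : Wt_act (simp_id n) p = p.
Proof.
have e : std_map (simp_id n) = hom_id (std_simplex n).
  by apply: sset_hom_ext => m x; apply: simp_idcomp.
have [v vE] := pb_eq (rho n (projT1 p)) e.
pose u := wo_iso_trans (wo_iso_sym (Wt_iso (simp_id n) (projT1 p)))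
            (wo_iso_trans v (pb_id _)).
apply: (@Wt_ext _ (Wt_act _ _) _ u) => /=.
by rewrite iso_funKE vE /= act_id.
Qed.

Lemma Wt_act_comp l m n (t : simp_hom m n) (s : simp_hom l m) (p : Wt_simp n) :
  Wt_act (simp_comp t s) p = Wt_act s (Wt_act t p).
Proof.
have e : std_map (simp_comp t s) = hom_comp (std_map t) (std_map s).
  by apply: sset_hom_ext => k x; apply/esym/simp_compA.
have [v vE] := pb_eq (rho n (projT1 p)) e.
pose u := wo_iso_trans (wo_iso_sym (Wt_iso (simp_comp t s) (projT1 p)))
            (wo_iso_trans v (wo_iso_trans (wo_iso_sym (pb_comp _ _ _))
               (wo_iso_trans (pb_iso (std_map s) (Wt_iso t (projT1 p)))
                  (Wt_iso s (act t (projT1 p)))))).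
apply: (@Wt_ext _ (Wt_act _ _) (Wt_act _ (Wt_act _ _)) u) => /=.
rewrite iso_funKE; congr (hom_fun _ _ _); apply: sig_ext => /=.
set p0 := exist _ _ _.
have := vE l p0; have /= := iso_prjE v p0.
case: (iso_fun v l p0) => [[x y] h] /= xE yE; subst x y; congr pair.
rewrite -hom_act; congr (hom_fun _ _ _); apply: sig_ext => /=.
by rewrite act_comp /act /= simp_compid simp_idcomp.
Qed.

Definition Wt : sSet := SSet (SsetStr Wt_act_id Wt_act_comp).

Definition Wt_prj : sset_hom Wt W :=
  @SsetHom Wt W (fun _ p => projT1 p) (fun _ _ _ _ => erefl).

(* The fiber of Wt over c is the fiber of the representative of c over the
   identity of [n]; it carries the ordering of the latter. *)
Definition Wt_fib n (c : W n) (p : fiber (Wt_prj n) c) :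
    fiber (prj (rho n c) n) (simp_id n) :=
  eq_rect _ (fun d => fiber (prj (rho n d) n) (simp_id n))
    (projT2 (proj1_sig p)) c (proj2_sig p).

Definition Wt_unfib n (c : W n) (s : fiber (prj (rho n c) n) (simp_id n)) :
    fiber (Wt_prj n) c :=
  exist (fun p => Wt_prj n p = c) (existT _ c s) erefl.

Lemma Wt_fibK n (c : W n) : cancel (@Wt_fib n c) (@Wt_unfib n c).
Proof. by case=> [[d s] /= dc]; case: _ / dc. Qed.

Lemma Wt_unfibK n (c : W n) : cancel (@Wt_unfib n c) (@Wt_fib n c).
Proof. by []. Qed.

Lemma Wt_relP n (c : W n) :
  well_order (fun p q : fiber (Wt_prj n) c => wo_rel (Wt_fib p) (Wt_fib q)).
Proof. by apply: wo_transport (@Wt_fibK n c) (@Wt_unfibK n c); apply: wo_relP. Qed.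

Lemma Wt_small : small A Wt_prj.
Proof.
move=> n c; apply: card_lt_can (@Wt_fibK n c) (@Wt_unfibK n c) _.
exact: (@prj_small _ _ _ (rho n c)).
Qed.

Definition W_univ : swo A W := @Swo A W Wt (SwoStr Wt_relP Wt_small).

Definition U_univ : swo A U := pullback U_incl W_univ.
End Universe.

(* Main.v *)
Require Import Defs.
From mathcomp Require Import all_boot classical_sets.
From mathcomp Require Import boolp wochoice.

(** A map into W is determined by the classes it assigns to simplices, so a
    well-ordered f over X can only be classified by the map sending x to the
    class of f restricted along x : Delta[n] -> X.  It is classified by that map
    because isomorphisms of well-ordered morphisms are unique: the chosen
    isomorphisms of the restrictions of f with the representatives are
    automatically compatible, hence glue.  Everything descends from W to U
    because a map is a Kan fibration as soon as its restriction to every simplex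
    of the base is one. *)

Set Implicit Arguments.
Unset Strict Implicit.
Unset Printing Implicit Defensive.

(** * Simplices as maps out of standard simplices *)

Lemma yoneda_subproof (X : sSet) n (x : X n) l m (t : simp_hom l m)
    (s : std_simplex n m) : act (act t s) x = act t (act s x).
Proof. exact: act_comp. Qed.

Definition yoneda (X : sSet) n (x : X n) : sset_hom (std_simplex n) X :=
  @SsetHom (std_simplex n) X (fun _ t => act t x) (yoneda_subproof x).

Lemma yonedaE (X : sSet) n (b : sset_hom (std_simplex n) X) :
  yoneda (b n (simp_id n)) = b.
Proof.
apply: sset_hom_ext => m t /=; rewrite -hom_act; congr (hom_fun b _ _).
exact: simp_idcomp.
Qed.

Lemma yoneda_std_map (X : sSet) m n (t : simp_hom m n) (x : X n) :
  hom_comp (yoneda x) (std_map t) = yoneda (act t x).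
Proof. by apply: sset_hom_ext => l s /=; rewrite act_comp. Qed.

Lemma yoneda_hom (X X' : sSet) (h : sset_hom X X') n (x : X n) :
  hom_comp h (yoneda x) = yoneda (h n x).
Proof. by apply: sset_hom_ext => l s /=; rewrite hom_act. Qed.

Section PullbackPair.
Variables (X X' Y Z : sSet) (g : sset_hom X' X) (f : sset_hom Y X).
Variables (a : sset_hom Z X') (b : sset_hom Z Y).
Hypothesis ab : hom_comp g a = hom_comp f b.

Definition pb_pair_fun n (z : Z n) : pb g f n :=
  exist (fun p : X' n * Y n => g n p.1 = f n p.2) (a n z, b n z) (sset_hom_eq ab z).

Lemma pb_pair_act m n (t : simp_hom m n) (z : Z n) :
  pb_pair_fun (act t z) = act t (pb_pair_fun z).
Proof. by apply: sig_ext; rewrite /= !hom_act. Qed.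

Definition pb_pair : sset_hom Z (pb g f) := SsetHom pb_pair_act.
End PullbackPair.

(** By [yonedaE] the base [b] of a lifting problem is given by a simplex [x]. The problem therefore
    comes from one in the pullback of [f] along [yoneda x], whose base is the identity. *)
Lemma kan_fibration_local (Y X : sSet) (f : sset_hom Y X) :
  (forall n (x : X n), kan_fibration (pb_fst (yoneda x) f)) -> kan_fibration f.
Proof.
move=> fK n k h b; rewrite -(yonedaE b); set x := b _ _ => hb.
have [|u [uh ub]] := fK _ x n k (pb_pair (esym hb)) (hom_id _).
  exact: sset_hom_ext.
exists (hom_comp (pb_snd _ _) u); split; apply: sset_hom_ext => m y /=.
  by have /(congr1 (fun p => (proj1_sig p).2)) := sset_hom_eq uh y.
rewrite -(proj2_sig (u m y)); congr act; exact (sset_hom_eq ub y).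
Qed.

(** * Isomorphisms of well-ordered morphisms *)

Section SwoIso.
Variables (A : Type) (X : sSet).

Lemma kan_fibration_iso (f g : swo A X) :
  wo_iso f g -> kan_fibration (prj f) -> kan_fibration (prj g).
Proof.
move=> u fK n k h b hb.
have [|v [vh vb]] := fK n k (hom_comp (iso_inv u) h) b.
  by rewrite -hb; apply: sset_hom_ext => m y /=; rewrite iso_prjVE.
exists (hom_comp (iso_fun u) v); split; apply: sset_hom_ext => m y.
  by have /= -> := sset_hom_eq vh y; rewrite iso_invKE.
by rewrite -vb /= iso_prjE.
Qed.

(** With two names for the base point, orders can be compared without a transport along [x = x']. *)
Lemma wo_rel_fiber (f : swo A X) n (x x' : X n)
    (y1 y2 : fiber (prj f n) x) (z1 z2 : fiber (prj f n) x') :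
  proj1_sig z1 = proj1_sig y1 -> proj1_sig z2 = proj1_sig y2 ->
  wo_rel z1 z2 = wo_rel y1 y2.
Proof.
case: y1 y2 z1 z2 => [y1 y1x] [y2 y2x] [z1 z1x] [z2 z2x] /= e1 e2.
subst z1 z2; have xx' : x = x' by rewrite -y1x z1x.
by case: _ / xx' in z1x z2x *; congr wo_rel; apply: sig_ext.
Qed.

(** A levelwise inverse of a simplicial map is automatically simplicial. *)
Lemma wo_iso_of_can (f g : swo A X) (u : sset_hom (tot f) (tot g))
    (v : forall n, tot g n -> tot f n) :
  (forall n, cancel (u n) (v n)) -> (forall n, cancel (v n) (u n)) ->
  hom_comp (prj g) u = prj f ->
  (forall n (x : X n) (y1 y2 : fiber (prj f n) x) (z1 z2 : fiber (prj g n) x),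
    proj1_sig z1 = u n (proj1_sig y1) -> proj1_sig z2 = u n (proj1_sig y2) ->
    wo_rel z1 z2 = wo_rel y1 y2) ->
  wo_iso f g.
Proof.
move=> uK vK uprj urel.
have vact m n (t : simp_hom m n) y : v m (act t y) = act t (v n y).
  by apply: (can_inj (uK m)); rewrite hom_act !vK.
exists u (SsetHom vact) => //; apply: sset_hom_ext => n y /=.
- exact: uK.
- exact: vK.
Qed.

Lemma wo_iso_pullback_comp (X' X'' : sSet) (g : sset_hom X' X)
    (k : sset_hom X'' X') (gk : sset_hom X'' X) (f : swo A X) :
  hom_comp g k = gk -> wo_iso (pullback k (pullback g f)) (pullback gk f).
Proof. by move=> <-; apply: pb_comp. Qed.
End SwoIso.

(** * The classifying map into W *)

Section Classify.
Variables (A : Type) (rho : representatives A).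

Lemma classify_act (X : sSet) (f : swo A X) m n (t : simp_hom m n) (x : X n) :
  class (pullback (yoneda (act t x)) f) =
  act t (class (pullback (yoneda x) f) : W A n).
Proof.
rewrite [RHS]class_pullbackE; apply/esym/class_eqP/squash.
exact/wo_iso_pullback_comp/yoneda_std_map.
Qed.

Definition classify (X : sSet) (f : swo A X) : sset_hom X (W A) :=
  @SsetHom X (W A) (fun _ x => class (pullback (yoneda x) f)) (classify_act f).

Section ClassifyIso.
Variables (X : sSet) (f : swo A X).

Lemma rep_iso_subproof n (x : X n) :
  $|wo_iso (pullback (yoneda x) f) (rho n (classify f n x))|.
Proof. by apply/class_eqP; rewrite rep_ofP. Qed.

Definition rep_iso n (x : X n) : wo_iso (pullback (yoneda x) f) (rho n (classify f n x)) :=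
  unsquash (rep_iso_subproof x).

Lemma id_pt_subproof n (x : X n) (y : fiber (prj f n) x) :
  yoneda x n (simp_id n) = prj f n (proj1_sig y).
Proof. by rewrite (proj2_sig y) /= act_id. Qed.

Definition id_pt n (x : X n) (y : fiber (prj f n) x) :
    fiber (prj (pullback (yoneda x) f) n) (simp_id n) :=
  exist _ (exist _ (simp_id n, proj1_sig y) (id_pt_subproof y)) erefl.

Definition to_Wt n (x : X n) (y : fiber (prj f n) x) : Wt rho n :=
  existT _ (classify f n x) (iso_fib (rep_iso x) (id_pt y)).

Definition act_fib m n (t : simp_hom m n) (x : X n) (y : fiber (prj f n) x) :
    fiber (prj f m) (act t x) :=
  exist _ (act t (proj1_sig y))
    (etrans (hom_act (prj f) t _) (congr1 (act t) (proj2_sig y))).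

(** This is the compatibility of the chosen isomorphisms. By [Wt_ext], which rests on their
    uniqueness, it is enough that some isomorphism of the two representatives matches the two
    points. *)
Lemma to_Wt_act m n (t : simp_hom m n) (x : X n) (y : fiber (prj f n) x) :
  to_Wt (act_fib t y) = act t (to_Wt y).
Proof.
have [v vE] := pb_eq f (esym (yoneda_std_map t x)).
(* From the representative at [act t x], [u] goes back to the restriction of [f] along [act t x],
   then through the restriction along [x] to the other representative. *)
pose u := wo_iso_trans (wo_iso_sym (rep_iso (act t x)))
            (wo_iso_trans v (wo_iso_trans (wo_iso_sym (pb_comp _ _ _))
               (wo_iso_trans (pb_iso (std_map t) (rep_iso x))
                  (Wt_iso rho t (classify f n x))))).
refine (@Wt_ext _ _ _ (to_Wt (act_fib t y)) (Wt_act t (to_Wt y)) u _) => /=.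
rewrite iso_funKE; congr (hom_fun _ _ _); apply: sig_ext => /=.
(* [v] is known only through its components: [iso_prjE] gives the first and [vE] the second. *)
set p0 := exist _ _ _.
have := vE m p0; have /= := iso_prjE v p0.
case: (iso_fun v m p0) => [[s z] h] /= sE zE; subst s z; congr pair.
rewrite -hom_act; congr (hom_fun _ _ _); apply: sig_ext => /=.
by rewrite /act /= simp_compid simp_idcomp.
Qed.

Definition to_pb n (x : X n) (y : fiber (prj f n) x) :
    tot (pullback (classify f) (W_univ rho)) n :=
  exist (fun p : X n * Wt rho n => classify f n p.1 = Wt_prj rho n p.2)
    (x, to_Wt y) erefl.

Definition classify_fun n (y : tot f n) :
    tot (pullback (classify f) (W_univ rho)) n :=
  to_pb (exist _ y erefl : fiber (prj f n) (prj f n y)).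

(** An element such as [act t y] can thus be treated as lying over [act t (prj f n y)], which equals
    its projection only propositionally. *)
Lemma classify_funE n (x : X n) (y : fiber (prj f n) x) :
  classify_fun (proj1_sig y) = to_pb y.
Proof. by case: y => y yx; case: _ / yx. Qed.

Lemma classify_fun_act m n (t : simp_hom m n) (y : tot f n) :
  classify_fun (act t y) = act t (classify_fun y).
Proof.
rewrite -[y]/(proj1_sig (exist (fun z => prj f n z = prj f n y) y erefl)).
set y' := exist _ y _.
rewrite -[act t _]/(proj1_sig (act_fib t y')) !classify_funE.
by apply: sig_ext; rewrite /= to_Wt_act.
Qed.

Definition classify_hom : sset_hom (tot f) (tot (pullback (classify f) (W_univ rho))) :=
  SsetHom classify_fun_act.

(** Only a family of functions: [wo_iso_of_can] supplies the compatibility with the action. *)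
Definition classify_inv n (p : tot (pullback (classify f) (W_univ rho)) n) : tot f n :=
  proj1_sig (pb_fib (iso_fib (wo_iso_sym (rep_iso (proj1_sig p).1))
    (Wt_fib (exist (fun q => Wt_prj rho n q = classify f n (proj1_sig p).1)
       (proj1_sig p).2 (esym (proj2_sig p)))))).

Lemma classify_funK n : cancel (classify_hom n) (@classify_inv n).
Proof. by move=> y; rewrite /classify_inv /= iso_funKE. Qed.

Lemma classify_invK n : cancel (@classify_inv n) (classify_hom n).
Proof.
case=> [[x [c s]] /= xc]; subst c.
set p := exist _ _ _.
have [z zE] : exists z, z = iso_inv (rep_iso x) n (proj1_sig s) by eexists.
have pE : classify_inv p = (proj1_sig z).2 by rewrite zE.
(* Since [z] lies over the identity of [n], its second component lies over [act (simp_id n) x], that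
   is, over [x]. *)
have zid : (proj1_sig z).1 = simp_id n.
  by rewrite zE -[LHS]/(prj (pullback (yoneda x) f) n _) iso_prjVE (proj2_sig s).
have yx : prj f n (classify_inv p) = x.
  by rewrite pE -(proj2_sig z) /= zid act_id.
rewrite (classify_funE (exist _ _ yx)); apply: sig_ext => /=; congr pair.
congr existT; apply: sig_ext => /=; rewrite -[RHS](iso_invKE (rep_iso x)) -zE.
congr (hom_fun _ _ _); apply: sig_ext.
by rewrite /= pE [RHS]surjective_pairing zid.
Qed.

Lemma Wt_fib_to_pb n (x : X n) (y : fiber (prj f n) x) :
  Wt_fib (pb_fib (exist _ (to_pb y) erefl : fiber (pb_fst (classify f) (Wt_prj rho) n) x))
  = iso_fib (rep_iso x) (id_pt y).
Proof. by rewrite -[RHS]Wt_unfibK; congr Wt_fib; apply: sig_ext. Qed.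

(** The fibers of [W_univ] are ordered as those of the representatives, and each [rep_iso x]
    preserves the order. *)
Lemma classify_rel n (x : X n) (y1 y2 : fiber (prj f n) x)
    (z1 z2 : fiber (prj (pullback (classify f) (W_univ rho)) n) x) :
  proj1_sig z1 = classify_hom n (proj1_sig y1) ->
  proj1_sig z2 = classify_hom n (proj1_sig y2) -> wo_rel z1 z2 = wo_rel y1 y2.
Proof.
rewrite /= !classify_funE => e1 e2.
have -> : z1 = exist _ (to_pb y1) erefl by apply: sig_ext.
have -> : z2 = exist _ (to_pb y2) erefl by apply: sig_ext.
rewrite -[LHS]/(wo_rel (Wt_fib (pb_fib _)) (Wt_fib (pb_fib _))) !Wt_fib_to_pb.
rewrite (iso_rel (w := rep_iso x) (y1 := id_pt y1) (y2 := id_pt y2)) //.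
by apply: (wo_rel_fiber (z1 := pb_fib (id_pt y1)) (z2 := pb_fib (id_pt y2))).
Qed.

Lemma classifyP : wo_iso f (pullback (classify f) (W_univ rho)).
Proof.
apply: wo_iso_of_can classify_funK classify_invK _ classify_rel.
exact: sset_hom_ext.
Qed.
End ClassifyIso.

(** Since [yoneda c] is the classifying map of the representative of [c], this is [classifyP] for
    that representative. *)
Lemma class_W_univ n (c : W A n) : class (pullback (yoneda c) (W_univ rho)) = c.
Proof.
rewrite -[RHS](rep_ofP rho); apply/class_eqP/squash/wo_iso_sym.
suff <- : classify (rho n c) = yoneda c by apply: classifyP.
apply: sset_hom_ext => m t /=; rewrite -[in RHS](rep_ofP rho c) [RHS]class_pullbackE.
congr (class (pullback _ _)); exact: sset_hom_ext.
Qed.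

(** Restricting the isomorphism along [yoneda x] and applying [class_W_univ] to [h n x] recovers [h]
    at [x]. *)
Lemma classify_uniq (X : sSet) (f : swo A X) (h : sset_hom X (W A)) :
  wo_iso f (pullback h (W_univ rho)) -> h = classify f.
Proof.
move=> u; apply: sset_hom_ext => n x /=; rewrite -[LHS]class_W_univ.
apply/class_eqP/squash/wo_iso_sym/(wo_iso_trans (pb_iso _ u)).
exact/wo_iso_pullback_comp/yoneda_hom.
Qed.

(** * Descent from W to U *)

Lemma U_univ_kan : kan_fibration (prj (U_univ rho)).
Proof.
(* The class [c] contains a fibration [f], and by [class_W_univ] the restriction of [U_univ] along
   [c] is isomorphic to [f]. *)
apply: kan_fibration_local => n c; have [f [fK /esym fc]] := proj2_sig c.
suff [u] : $|wo_iso f (pullback (yoneda c) (U_univ rho))| by apply: kan_fibration_iso u fK.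
apply/class_eqP; rewrite -fc -[LHS]class_W_univ.
apply/esym/class_eqP/squash/wo_iso_pullback_comp/yoneda_hom.
Qed.

Lemma classify_kan (X : sSet) (f : swo A X) :
  kan_fibration (prj f) -> forall n (x : X n), fibrant_class (classify f n x).
Proof. by move=> fK n x; exists (pullback (yoneda x) f); split=> //; apply: pb_kan. Qed.

Section ClassifyU.
Variables (X : sSet) (f : swo A X).
Hypothesis fK : kan_fibration (prj f).

Definition classifyU_fun n (x : X n) : U A n := exist _ _ (classify_kan fK x).

Lemma classifyU_act m n (t : simp_hom m n) (x : X n) :
  classifyU_fun (act t x) = act t (classifyU_fun x).
Proof. by apply: sig_ext; rewrite /= classify_act. Qed.

Definition classifyU : sset_hom X (U A) := SsetHom classifyU_act.

Lemma classifyUP : wo_iso f (pullback classifyU (U_univ rho)).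
Proof.
apply: wo_iso_trans (classifyP f) (wo_iso_sym (wo_iso_pullback_comp _ _)).
exact: sset_hom_ext.
Qed.
End ClassifyU.

(** [U_incl] is injective on simplices, so uniqueness is inherited from maps into W. *)
Lemma U_hom_uniq (X : sSet) (f : swo A X) (h h' : sset_hom X (U A)) :
  $|wo_iso f (pullback h (U_univ rho))| -> $|wo_iso f (pullback h' (U_univ rho))| ->
  h = h'.
Proof.
have toW k : $|wo_iso f (pullback k (U_univ rho))| ->
    hom_comp (@U_incl A) k = classify f.
  by case=> u; apply/classify_uniq/(wo_iso_trans u)/wo_iso_pullback_comp.
move=> /toW hf /toW h'f; apply: sset_hom_ext => n x; apply: sig_ext.
exact (sset_hom_eq (etrans hf (esym h'f)) x).
Qed.

(** The class of [U_univ] is the universal element. Pulling it back is surjective by [classifyUP]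
    and injective by [U_hom_uniq]. *)
Lemma U_represents : represented_by (U_functor A) (U A).
Proof.
have univK : fibrant_class (class (U_univ rho)).
  by exists (U_univ rho); split=> //; apply: U_univ_kan.
pose c : U_functor A (U A) := exist _ _ univK.
exists (fun X h => psh_map h c); split=> [X X' g h | X]; first exact: psh_comp.
have etaP (d : U_functor A X) : exists h : sset_hom X (U A), psh_map h c = d.
  case: d => d dK; have [f [fK fd]] := dK.
  exists (classifyU fK); apply: sig_ext => /=; rewrite class_pullbackE -fd.
  exact/esym/class_eqP/squash/classifyUP.
exists (fun d => proj1_sig (cid (etaP d))) => [h | d]; last by case: cid.
case: cid => h' /= /(congr1 (@proj1_sig _ _)) /=; rewrite !class_pullbackE.
by move=> /class_eqP; apply: U_hom_uniq; apply/squash/wo_iso_refl.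
Qed.
End Classify.

(** Choice well-orders each fiber separately. Different orders may give different classifying maps,
    whence only weak universality for unordered fibrations. *)
Lemma swo_of_small (A : Type) (Y X : sSet) (f : sset_hom Y X) :
  small A f -> exists s : swo_str A X Y, prj s = f.
Proof.
move=> fA; have wo n (x : X n) := @well_ordering_principle {classic fiber (f n) x}.
by exists (@SwoStr A X Y f (fun n x => sval (wo n x)) (fun n x => svalP (wo n x)) fA).
Qed.

Theorem corollary13 (A : Type) (A_regular : regular A) (rho : representatives A) :
  represented_by (U_functor A) (U A) /\
  (kan_fibration (prj (U_univ rho)) /\
   forall (X : sSet) (f : swo A X), kan_fibration (prj f) ->
     exists! h : sset_hom X (U A), $|wo_iso f (pullback h (U_univ rho))|) /\
  (forall (X Y : sSet) (f : sset_hom Y X), small A f -> kan_fibration f ->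
     exists h : sset_hom X (U A), iso_over f (prj (pullback h (U_univ rho)))).
Proof.
split; first exact: U_represents rho.
split; first split; first exact: U_univ_kan.
  move=> X f fK; exists (classifyU fK); split=> [|h]; first exact/squash/classifyUP.
  exact/U_hom_uniq/squash/classifyUP.
move=> X Y f /swo_of_small[s <-] sK.
have u := classifyUP rho (f := Swo s) sK.
exists (classifyU (f := Swo s) sK), (iso_fun u), (iso_inv u).
by split; [exact (iso_funK u) | exact (iso_invK u) | exact (iso_prj u)].
Qed.
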